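(* Let $x^0\in X$ and $0<\varepsilon<f(x^0)-f^*$. Set $\beta=1/2$ and choose $\rho\in[\min\{\mu^*,L\},\max\{\mu^*,L\}]$. Let $\gamma_\rho:=1-\beta/\max\{2,4\rho/\mu^*\}$ and $\theta_\rho:=L/(L+(1-\beta)\rho)$. Then the full-memory proximal bundle method (FM-PBM) with inputs $x^0,\rho,\beta$ reaches a serious center $x^t$ satisfying $f(x^t)-f^*\le\varepsilon$ after at most $$T_\varepsilon^{\rm FM}=O\Bigg(k\left(1+\frac{L}{\mu^*}\right)\left[1+\log\frac{f(x^0)-f^*}{\varepsilon\min\{1,\mu^*/\rho\}}\right]+k\left(1+\frac L\rho\right)\log\frac{2\|g(x^0)\|^2}{\min\{\rho,\mu^*\}\varepsilon}\Bigg)$$ first-order oracle calls. In particular: (i) If $\rho=\mu^*$, then $\gamma_{\mu^*}=7/8$ and $\theta_{\mu^*}=L/(L+\mu^*/2)$, and the bound becomes $$T_\varepsilon^{\rm FM}=O\left(k\left(1+\frac L{\mu^*}\right)\left[1+\log\frac{f(x^0)-f^*}{\varepsilon}+\log\frac{2\|g(x^0)\|^2}{\mu^*\varepsilon}\right]\right).$$ (ii) If $\rho=L$, then $\theta_L=2/3$ and $\gamma_L=1-1/(2\max\{2,4L/\mu^*\})$, and the bound becomes $$T_\varepsilon^{\rm FM}=O\Bigg(k\left(1+\frac L{\mu^*}\right)\left[1+\log\frac{(1+L/\mu^* )(f(x^0)-f^* )}{\varepsilon}\right]+k\log\frac{2\|g(x^0)\|^2}{\min\{L,\mu^*\}\v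arepsilon}\Bigg).$$
   Context: Setting. $X\subseteq\mathbb R^n$ is a nonempty closed convex set, $f:X\to\mathbb R$ is convex, lower semicontinuous and attains its minimum $f^*=\min_{X}f$; $X^*=\operatorname{argmin}_X f$. $\|\cdot\|$, $\langle\cdot,\cdot\rangle$ are the Euclidean norm and inner product. For $x\in X$, $\partial f(x)=\{v\in\mathbb R^n: f(z)\ge f(x)+\langle v,z-x\rangle\ \forall z\in X\}$. A first-order oracle returns, at any $u\in X$, $f(u)$ and a subgradient $g(u)\in\partial f(u)$; $\ell_f(x;u):=f(u)+\langle g(u),x-u\rangle$ is the corresponding cutting plane. Piecewise smoothness. $k\in\mathbb N_+$, $L>0$, and $f$ is $(k,L)$-piecewise smooth: there are $k$ subsets $X_1,\dots,X_k$ of $X$ (pieces) covering $X$ such that each restriction $f|_{X_i}$ is $L$-smooth; this is used together with the oracle assumption that $f(x)-\ell_f(x;\bar x)\le\frac L2\|x-\bar x\|^2$ for all $i\in\{1,\dots,k\}$ and all $x,\bar x\in X_i$. Quadratic growth. $\mu^*:=\sup\{\nu>0: f(x)-f^*\ge\frac\nu2\operatorname{dist}^2(x,X^* )\ \forall x\in X\}$, and $0<\mu^*<\infty$ is assumed. FM-PBM. Input $x^0\in X$, $\rho>0$, $\beta\in(0,1)$. Set $\psi^0=\ell_f(\cdot;x^0)$. For $t=0,1,\dots$: compute $y^t=\operatorname{argmin}_{x\in X}\{\psi^t(x)+\frac\rho2\|x-x^t\|^2\}$. If $f(x^t)-f(y^t)\ge\beta(f(x^t)-\psi^t(y^t))$,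 iteration $t$ is a serious step and $x^{t+1}=y^t$; otherwise it is a null step and $x^{t+1}=x^t$. Set $\psi^{t+1}(x)=\max\{\psi^t(x),\ell_f(x;y^t)\}$. A serious center is a center $x^t$ produced by a serious step. The oracle is called once at $x^0$ and once at each trial point $y^t$. $O(\cdot)$ hides an absolute constant. *)

(* Defs.v *)
From mathcomp Require Import all_boot all_order all_algebra.
From mathcomp Require Import all_classical all_reals all_analysis.

Set Implicit Arguments.
Unset Strict Implicit.
Unset Printing Implicit Defensive.

Import Order.TTheory GRing.Theory Num.Theory.
Import numFieldNormedType.Exports.

Local Open Scope classical_set_scope.
Local Open Scope ring_scope.

Section Euclidean.
Context {R : realType} {n : nat}.
Implicit Types (x u v : 'rV[R]_n) (S : set 'rV[R]_n).

Definition dot u v : R := \sum_(i < n) u 0 i * v 0 i.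

(* The library norm `|x| on 'rV[R]_n is the sup norm, so the Euclidean norm is
   defined here; both induce the library topology. *)
Definition enorm x : R := Num.sqrt (dot x x).

Definition edist x S : R := inf [set enorm (x - z) | z in S].

End Euclidean.

(* A function on X is represented by a total f : 'rV[R]_n -> R, of which only
   the values on X are used. *)
Section Convex.
Context {R : realType} {n : nat}.
Implicit Types (X A : set 'rV[R]_n) (f : 'rV[R]_n -> R).
Implicit Types (g G : 'rV[R]_n -> 'rV[R]_n).

Definition argmin X f : set 'rV[R]_n :=
  [set x | X x /\ forall z, X z -> f x <= f z].

(* This is min_X f whenever argmin X f is nonempty. *)
Definition min_value X f : R := inf (f @` X).

(* Lower semicontinuity relative to X: points outside X are isolated in the
   topology of subspace X, so they impose no condition. *)
Definition lsc_on X f : Prop :=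
  lower_semicontinuous ((fun x => (f x)%:E) : subspace X -> \bar R).

Definition subdifferential X f (x : 'rV[R]_n) : set 'rV[R]_n :=
  [set v | forall z, X z -> f x + dot v (z - x) <= f z].

Definition first_order_oracle X f g : Prop :=
  forall u, X u -> subdifferential X f u (g u).

(* cut f g u x is the value at x of the cutting plane built at u. *)
Definition cut f g (u x : 'rV[R]_n) : R := f u + dot (g u) (x - u).

Definition gradient_within A f (x v : 'rV[R]_n) : Prop :=
  forall e : R, 0 < e -> \forall z \near within A (nbhs x),
    `|f z - f x - dot v (z - x)| <= e * enorm (z - x).

(* The restriction of f to A is L-smooth: it is differentiable relative to A,
   with an L-Lipschitz gradient. *)
Definition smooth_on A f (L : R) : Prop :=
  exists2 G, (forall x, A x -> gradient_within A f x (G x)) &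
    forall x z, A x -> A z -> enorm (G x - G z) <= L * enorm (x - z).

Definition piecewise_smooth X f (k : nat) (L : R)
    (P : 'I_k -> set 'rV[R]_n) : Prop :=
  [/\ forall i, P i `<=` X,
      X `<=` \bigcup_i P i &
      forall i, smooth_on (P i) f L].

Definition oracle_smooth f g (k : nat) (L : R)
    (P : 'I_k -> set 'rV[R]_n) : Prop :=
  forall i x u, P i x -> P i u ->
    f x - cut f g u x <= L / 2 * enorm (x - u) ^+ 2.

Definition quadratic_growth X f (nu : R) : Prop :=
  forall x, X x ->
    nu / 2 * edist x (argmin X f) ^+ 2 <= f x - min_value X f.

Definition growth_modulus X f : \bar R :=
  ereal_sup [set nu%:E | nu in [set nu : R | 0 < nu /\ quadratic_growth X f nu]].

End Convex.

Section ProximalBundle.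
Context {R : realType} {n : nat}.
Variables (X : set 'rV[R]_n) (f : 'rV[R]_n -> R) (g : 'rV[R]_n -> 'rV[R]_n).
Variables (x0 : 'rV[R]_n) (rho beta : R).
(* centers x^t, trial points y^t and models psi^t *)
Variables (x y : nat -> 'rV[R]_n) (psi : nat -> 'rV[R]_n -> R).

Definition serious_step (t : nat) : bool :=
  beta * (f (x t) - psi t (y t)) <= f (x t) - f (y t).

Record fm_pbm : Prop := FMPBM {
  fm_pbm_x0 : x 0%N = x0 ;
  fm_pbm_psi0 : forall z, psi 0%N z = cut f g x0 z ;
  fm_pbm_trial : forall t,
    argmin X (fun z => psi t z + rho / 2 * enorm (z - x t) ^+ 2) (y t) ;
  fm_pbm_center : forall t, x t.+1 = if serious_step t then y t else x t ;
  fm_pbm_model : forall t z,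
    psi t.+1 z = Num.max (psi t z) (cut f g (y t) z)
}.

(* The center x^t is known after one call at x0 and one at each of
   y^0, ..., y^(t-1). *)
Definition oracle_calls (t : nat) : nat := (1 + t)%N.

(* A serious center is a center produced by a serious step, hence the index
   t.+1; the initial center x0 is not one. *)
Definition serious_center_within (eps T : R) : Prop :=
  exists t : nat, [/\ serious_step t,
    f (x t.+1) - min_value X f <= eps &
    (oracle_calls t.+1)%:R <= T].

End ProximalBundle.

Definition gamma_rate {R : realType} (beta mu rho : R) : R :=
  1 - beta / Num.max 2 (4 * rho / mu).

Definition theta_rate {R : realType} (beta L rho : R) : R :=
  L / (L + (1 - beta) * rho).

(* Main.v *)
Require Import Defs.
From mathcomp Require Import all_boot all_order all_algebra.
From mathcomp Require Import all_classical all_reals all_analysis.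
From mathcomp Require Import ring lra.

(** The proof follows the quantity
      [model_gap t = f (x t) - min_X (psi t + rho / 2 * |. - x t|^2)],
    the decrease that the current model predicts for a proximal step.

    Each iteration acts on it in a controlled way. A null step cannot increase
    it ([model_gap_null]), because the center stays and the model only grows. If
    two null steps between consecutive serious steps have their trial points in
    the same piece, the later gap is smaller than the earlier one by the factor
    [theta_rate] ([model_gap_repeat]): the plane cut at the first trial point is
    accurate to second order at the second one, so a poor model there forces the
    two points apart, and strong convexity of the proximal subproblem turns
    this distance into a rise of its optimal value. A serious step multiplies
    the gap by at most 3 ([model_gap_serious]), because all cuts survive the
    change of center.

    Quadratic growth bounds this quantity below by the excess
    [f (x t) - min f] divided by [M = max (2, 4 rho / mu)]
    ([model_gap_ge_excess]). Hence serious steps contract the excess by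
    [gamma_rate], so that there are
    [O (M * ln ((f x0 - min f) / eps))] of them, and
    [model_gap t >= eps / M] until the target is met. The initial value
    [model_gap 0] is at most [|g x0|^2 / (2 rho)].

    These facts are combined by counting piece by piece over the whole run
    instead of cycle by cycle ([potential_le]). With [q = 1 / theta_rate], each
    null step in the piece [i] gains a factor [q], except the first one of
    every cycle, and each serious step loses a factor 3. So if [S] steps were
    serious and [N] null steps fell in the piece [i], then
      [model_gap t * q ^ N <= q * (3 * q) ^ S * model_gap 0].
    Taking logarithms and summing over the pieces, the ratio of the first to
    the last gap enters the bound once, and not once per serious step. This
    is why the logarithm of [|g x0|^2] is added to that of [f x0 - min f] and
    does not multiply it. *)

Set Implicit Arguments.
Unset Strict Implicit.
Unset Printing Implicit Defensive.

Import Order.TTheory GRing.Theory Num.Theory.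
Import numFieldNormedType.Exports.

Local Open Scope classical_set_scope.
Local Open Scope ring_scope.

(** * Euclidean norm and distance *)

Section EuclideanNorm.
Context {R : realType} {n : nat}.
Implicit Types u v w x z : 'rV[R]_n.

Lemma dotC u v : dot u v = dot v u.
Proof. by apply: eq_bigr => i _; rewrite mulrC. Qed.

Lemma dotDr u v w : dot u (v + w) = dot u v + dot u w.
Proof. by rewrite -big_split; apply: eq_bigr => i _; rewrite mxE mulrDr. Qed.

Lemma dotZr a u v : dot u (a *: v) = a * dot u v.
Proof. by rewrite mulr_sumr; apply: eq_bigr => i _; rewrite mxE mulrCA. Qed.

Lemma enorm_sqr u : enorm u ^+ 2 = dot u u.
Proof. by rewrite sqr_sqrtr// sumr_ge0// => i _; rewrite -expr2 sqr_ge0. Qed.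

Lemma enorm_sqrD u v :
  enorm (u + v) ^+ 2 = enorm u ^+ 2 + 2 * dot u v + enorm v ^+ 2.
Proof.
by rewrite !enorm_sqr dotDr ![dot (u + v) _]dotC !dotDr (dotC v u); ring.
Qed.

Lemma enorm_sqrZ a u : enorm (a *: u) ^+ 2 = a ^+ 2 * enorm u ^+ 2.
Proof. by rewrite !enorm_sqr dotZr dotC dotZr mulrA expr2. Qed.

Lemma enorm_sqr_distC u v : enorm (u - v) ^+ 2 = enorm (v - u) ^+ 2.
Proof. by rewrite -opprB -scaleN1r enorm_sqrZ sqrrN expr1n mul1r. Qed.

Lemma enorm_sqr0 : enorm (0 : 'rV[R]_n) ^+ 2 = 0.
Proof. by rewrite -(scale0r 0) enorm_sqrZ expr0n mul0r. Qed.

Lemma enorm_sqrD_le u v :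
  enorm (u + v) ^+ 2 <= 2 * enorm u ^+ 2 + 2 * enorm v ^+ 2.
Proof.
have := sqr_ge0 (enorm (u + -1 *: v)).
by rewrite !enorm_sqrD enorm_sqrZ dotZr; lra.
Qed.

(** The square of [u + a *: w] is nonnegative. *)
Lemma dot_enorm_sqr_ge a u w : 0 < a ->
  - (enorm u ^+ 2 / (2 * a)) <= dot u w + a / 2 * enorm w ^+ 2.
Proof.
move=> a0; have := sqr_ge0 (enorm (u + a *: w)).
rewrite enorm_sqrD enorm_sqrZ dotZr => H.
rewrite -subr_ge0 (_ : _ - _ =
  (enorm u ^+ 2 + 2 * (a * dot u w) + a ^+ 2 * enorm w ^+ 2) / (2 * a));
  last first.
  by field; rewrite gt_eqF.
by rewrite divr_ge0//; lra.
Qed.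

(** Lets a bound valid for every point of [S] pass to the distance without a
    nearest point. *)
Lemma edist_sqr_ge x (S : set 'rV[R]_n) c : S !=set0 ->
  (forall z, S z -> c <= enorm (x - z) ^+ 2) -> c <= Defs.edist x S ^+ 2.
Proof.
move=> [z0 Sz0] cS.
have [c0|c0] := leP c 0; first exact: le_trans (sqr_ge0 _).
rewrite -[leLHS]sqr_sqrtr ?(ltW c0)//.
have le_d : Num.sqrt c <= Defs.edist x S.
  apply: lb_le_inf; first by exists (enorm (x - z0)); exists z0.
  move=> _ [z Sz <-].
  by rewrite -[leRHS]ger0_norm ?sqrtr_ge0// -sqrtr_sqr ler_wsqrtr ?cS.
by apply: lerXn2r => //; rewrite nnegrE ?(le_trans _ le_d) ?sqrtr_ge0.
Qed.

End EuclideanNorm.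

(** * Convexity and the proximal subproblem *)

Section Convexity.
Context {R : realType} {n : nat}.
Implicit Types (X : set 'rV[R]_n) (f psi : 'rV[R]_n -> R) (c y z : 'rV[R]_n).

Let conv_segment (s : {i01 R}) y z :
  conv s (z : convex_lmodType 'rV[R]_n) y = y + s%:num *: (z - y).
Proof.
by rewrite /conv /= /unstable.onem scalerBl scalerBr scale1r addrCA addrA.
Qed.

Lemma convex_set_segment X y z (s : R) : convex_set X -> X y -> X z ->
  0 <= s -> s <= 1 -> X (y + s *: (z - y)).
Proof.
move=> cX Xy Xz s0 s1; have := cX z y (Itv01 s0 s1).
by rewrite !inE conv_segment; exact.
Qed.

Lemma convex_function_segment X f y z (s : R) : convex_function X f ->
  X y -> X z -> 0 <= s -> s <= 1 ->
  f (y + s *: (z - y)) <= f y + s * (f z - f y).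
Proof.
move=> cf Xy Xz s0 s1; have := cf (Itv01 s0 s1) z y.
rewrite !inE conv_segment convRE /= /unstable.onem => /(_ Xz Xy) /le_trans.
by apply; lra.
Qed.

Lemma convex_function_cut X f (g : 'rV[R]_n -> 'rV[R]_n) u :
  convex_function X (Defs.cut f g u).
Proof.
move=> s z y _ _; rewrite conv_segment convRE /Defs.cut /unstable.onem.
have -> : y + s%:num *: (z - y) - u
    = y - u + s%:num *: (z - u + -1 *: (y - u)).
  by rewrite scaleN1r opprB addrA subrK addrAC.
rewrite (dotDr _ (y - u)) dotZr (dotDr _ (z - u)) dotZr.
by rewrite le_eqVlt; apply/orP/or_introl/eqP; ring.
Qed.

Lemma convex_function_max X f1 f2 : convex_function X f1 ->
  convex_function X f2 -> convex_function X (fun z => Num.max (f1 z) (f2 z)).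
Proof.
move=> c1 c2 s z y Xz Xy; rewrite convRE.
have s0 : 0 <= s%:num by [].
have s1 : 0 <= 1 - s%:num by rewrite subr_ge0.
rewrite ge_max; apply/andP; split.
- apply: (le_trans (c1 s z y Xz Xy)); rewrite convRE.
  by rewrite lerD// ler_wpM2l// le_max lexx.
- apply: (le_trans (c2 s z y Xz Xy)); rewrite convRE.
  by rewrite lerD// ler_wpM2l// le_max lexx ?orbT.
Qed.

Lemma min_valueE X f z : argmin X f z -> min_value X f = f z.
Proof.
move=> [Xz fz]; apply/eqP; rewrite eq_le; apply/andP; split.
- apply: ge_inf; last by exists z.
  by exists (f z) => _ [w Xw <-]; exact: fz.
- apply: lb_le_inf; first by exists (f z); exists z.
  by move=> _ [w Xw <-]; exact: fz.
Qed.

(** The quadratic growth inequality is closed under limits of the constant, so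
    the supremum defining the modulus is attained. *)
Lemma quadratic_growth_modulus X f (mu : R) : argmin X f !=set0 ->
  growth_modulus X f = mu%:E -> quadratic_growth X f mu.
Proof.
move=> [z zmin] muE w Xw.
have h0 : 0 <= f w - min_value X f.
  by rewrite (min_valueE zmin) subr_ge0 zmin.2.
set d := Defs.edist _ _ ^+ 2; have [d0|] := ltP 0 d; last first.
  by rewrite le_eqVlt ltNge sqr_ge0 orbF => /eqP ->; rewrite mulr0.
rewrite leNgt; apply/negP => hlt.
have : ((2 * (f w - min_value X f) / d)%:E < growth_modulus X f)%E.
  by rewrite muE lte_fin ltr_pdivrMr//; clear muE; lra.
move=> /ereal_sup_gt[_ [nu [_ /(_ w Xw) nuw] <-]].
rewrite lte_fin ltr_pdivrMr// => nu_gt; rewrite -/d in nuw.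
by clear muE; lra.
Qed.

(** The proximal term makes the objective [rho]-strongly convex: comparing [y]
    with points of the segment from [y] to [z] and letting them tend to [y]
    gives the variational inequality at [y]. *)
Lemma prox_strong_convexity X psi (rho : R) c y z : 0 < rho ->
  convex_set X -> convex_function X psi ->
  argmin X (fun w => psi w + rho / 2 * enorm (w - c) ^+ 2) y -> X z ->
  psi y + rho / 2 * enorm (y - c) ^+ 2 + rho / 2 * enorm (z - y) ^+ 2
    <= psi z + rho / 2 * enorm (z - c) ^+ 2.
Proof.
move=> rho0 cX cpsi [Xy ymin] Xz.
set B := psi z - psi y + rho * dot (y - c) (z - y).
set a := rho / 2 * enorm (z - y) ^+ 2.
have a0 : 0 <= a by rewrite mulr_ge0 ?sqr_ge0// divr_ge0// ltW.
have small s : 0 < s -> s <= 1 -> 0 <= B + s * a.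
  move=> s0 s1.
  have := ymin _ (convex_set_segment cX Xy Xz (ltW s0) s1).
  rewrite /= [y + _ - c]addrAC (enorm_sqrD (y - c)) enorm_sqrZ dotZr.
  have := convex_function_segment cpsi Xy Xz (ltW s0) s1.
  by move=> ? ?; rewrite -(pmulr_rge0 _ s0) /B /a; lra.
have B0 : 0 <= B.
  rewrite leNgt; apply/negP => B0.
  (* this step length makes [B + s * a] equal to [- B ^ 2 / (a - B)] *)
  have aB : 0 < a - B by lra.
  have := small (- B / (a - B)); rewrite divr_gt0 ?oppr_gt0//.
  rewrite ler_pdivrMr// mul1r lerDr => /(_ isT a0).
  rewrite (_ : _ + _ = - (B ^+ 2 / (a - B))); last by field; rewrite gt_eqF.
  rewrite oppr_ge0 leNgt divr_gt0//.
  by rewrite exprn_even_gt0//= lt_eqF.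
have -> : z - c = y - c + (z - y) by rewrite [RHS]addrC subrKA.
by rewrite (enorm_sqrD (y - c)); rewrite /a; rewrite /B in B0; lra.
Qed.

End Convexity.

(** * Counting steps with a potential *)

(** An abstract run: [D] is a nonnegative potential, a reset multiplies it by
    at most [c], and a repeated label between two resets divides it by at
    least [q].
    For the bundle method, resets are the serious steps and labels the pieces
    that contain the trial points. *)
Section Potential.
Context {R : realType} {k : nat}.
Variables (D : nat -> R) (reset : nat -> bool) (label : nat -> 'I_k) (c q : R).
Hypotheses (c_gt0 : 0 < c) (q_ge1 : 1 <= q).
Hypothesis D_reset : forall t, reset t -> D t.+1 <= c * D t.
Hypothesis D_step : forall t, ~~ reset t -> D t.+1 <= D t.
Hypothesis D_repeat : forall s t, (s < t)%N ->
  (forall r, (s <= r <= t)%N -> ~~ reset r) -> label s = label t ->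
  q * D t <= D s.

Definition resets (t : nat) : nat := \sum_(s < t) reset s.

Definition visits (i : 'I_k) (t : nat) : nat :=
  \sum_(s < t) (~~ reset s && (label s == i)).

Lemma resets_visits t : (resets t + \sum_(i < k) visits i t)%N = t.
Proof.
rewrite /resets /visits exchange_big -big_split /=.
rewrite -[RHS]card_ord -sum1_card; apply: eq_bigr => s _.
case: (reset s) => /=; first by rewrite big1.
rewrite (bigD1 (label s)) //= eqxx big1 // => i /negPf.
by rewrite eq_sym => ->.
Qed.

(** Each visit to [i] is paid by a factor [q], except the first one after each
    reset; the latter are refunded by the factor [q] attached to each reset, and
    by the one in front for the stretch that begins the run. *)
Lemma potential_le i t : 0 <= D 0%N -> 0 <= D t ->
  D t * q ^+ visits i t <= q * (c * q) ^+ resets t * D 0%N.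
Proof.
move=> D0 Dt.
have q0 : 0 < q by rewrite (lt_le_trans ltr01).
have qX0 m : 0 <= q ^+ m by rewrite exprn_ge0// ltW.
have cq0 : 0 < c * q by rewrite mulr_gt0.
(* Either [i] has not been visited since the last reset, and the estimate holds
   without the factor in front, or [s] is its last visit and the estimate holds
   already for [D s], which leaves [D t] free to gain [q] at the next visit. *)
suff [Inv|[s [_ _ _ Dts Inv]]] :
    D t * q ^+ visits i t <= (c * q) ^+ resets t * D 0%N \/
    exists s, [/\ (s < t)%N, forall r, (s <= r < t)%N -> ~~ reset r,
      label s = i, D t <= D s &
      D s * q ^+ visits i t <= q * (c * q) ^+ resets t * D 0%N].
- apply: (le_trans Inv); rewrite -mulrA ler_peMl// mulr_ge0//.
  by rewrite exprn_ge0// ltW.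
- by apply: le_trans Inv; rewrite ler_wpM2r.
elim: t {Dt} => [|t IH].
  by left; rewrite /visits /resets !big_ord0 !expr0 mulr1 mul1r.
have resetsS : resets t.+1 = (resets t + reset t)%N by exact: big_ord_recr.
have visitsS : visits i t.+1 = (visits i t + (~~ reset t && (label t == i)))%N.
  exact: big_ord_recr.
rewrite resetsS visitsS.
have [rt|nrt] := boolP (reset t).
  rewrite addn0 addn1 exprS; left.
  apply: (@le_trans _ _ (c * (D t * q ^+ visits i t))).
    by rewrite mulrA ler_wpM2r// D_reset.
  rewrite -!mulrA ler_pM2l//.
  case: IH => [Inv|[s [_ _ _ Dts Inv]]].
    by apply: (le_trans Inv); rewrite ler_peMl// mulr_ge0// exprn_ge0// ltW.
  by rewrite mulrA; apply: le_trans Inv; rewrite ler_wpM2r.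
rewrite addn0; have Dt := D_step nrt.
have [lt_i|_] := eqVneq (label t) i; last first.
  rewrite addn0; case: IH => [Inv|[s [st nr ls Dts Inv]]].
    by left; apply: le_trans Inv; rewrite ler_wpM2r.
  right; exists s; split=> //; first exact: ltnW.
    move=> r /andP[sr]; rewrite ltnS leq_eqVlt => /predU1P[->//|rt].
    by rewrite nr// sr rt.
  exact: le_trans Dt Dts.
right; exists t; split=> //.
  by move=> r; rewrite ltnS -eqn_leq => /eqP <-.
rewrite addn1 exprS mulrCA.
case: IH => [Inv|[s [st nr ls Dts Inv]]].
  by rewrite -mulrA ler_pM2l.
rewrite mulrA; apply: le_trans Inv; rewrite ler_wpM2r// D_repeat//.
  move=> r /andP[sr]; rewrite leq_eqVlt => /predU1P[->//|rt].
  by rewrite nr// sr rt.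
by rewrite ls.
Qed.

(** The logarithm of [potential_le], summed over all labels. *)
Lemma potential_count t : 1 < q -> 0 < D 0%N -> 0 < D t ->
  t%:R <= (resets t)%:R + k%:R * ((resets t).+1%:R
    + ((resets t)%:R * ln c + ln (D 0%N / D t)) / ln q).
Proof.
move=> q1 D0 Dt.
have q0 : 0 < q by rewrite (lt_le_trans ltr01).
have lnq0 : 0 < ln q by rewrite ln_gt0.
set B := _.+1%:R + _ / _.
have visitsB i : (visits i t)%:R <= B.
  have := potential_le i (ltW D0) (ltW Dt).
  rewrite -ler_ln ?posrE ?mulr_gt0 ?exprn_gt0 ?mulr_gt0//.
  rewrite !lnM ?posrE ?mulr_gt0 ?exprn_gt0 ?mulr_gt0//.
  rewrite !lnXn ?mulr_gt0// lnM// -[ln q *+ _]mulr_natr.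
  rewrite -[(ln c + _) *+ _]mulr_natr => H.
  rewrite -(ler_pM2r lnq0) mulrDl divfK ?gt_eqF//.
  by rewrite ln_div// -natr1; lra.
rewrite -[in leLHS](resets_visits t) natrD lerD2l natr_sum.
apply: le_trans (_ : \sum_(i < k) B <= _); first by apply: ler_sum => i _.
by rewrite sumr_const card_ord mulr_natl.
Qed.

End Potential.

(** * The predicted decrease of a proximal step *)

Section ProxGap.
Context {R : realType} {n : nat}.
Variables (X : set 'rV[R]_n) (f psi : 'rV[R]_n -> R) (rho mu : R).
Hypotheses (cX : convex_set X) (cf : convex_function X f).
Hypotheses (rho_gt0 : 0 < rho) (mu_gt0 : 0 < mu).
Hypothesis psi_le : forall z, X z -> psi z <= f z.

Definition prox_gap (x y : 'rV[R]_n) : R :=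
  f x - (psi y + rho / 2 * enorm (y - x) ^+ 2).

Let prox x := argmin X (fun z => psi z + rho / 2 * enorm (z - x) ^+ 2).

(** Moving from [x] a fraction [s] of the way to a minimizer [z] decreases [f]
    by at least [s] times the excess at [x] and costs
    [rho / 2 * s ^+ 2 * |z - x|^2]; for [z] close to the nearest minimizer,
    quadratic growth bounds this cost by about [rho / mu * s ^+ 2] times that
    excess. With [s = 2 / M], where [M] is the maximum in the statement, the cost
    is at most half of the decrease. *)
Lemma prox_gap_ge x y : argmin X f !=set0 -> quadratic_growth X f mu ->
  X x -> prox x y ->
  (f x - min_value X f) / Num.max 2 (4 * rho / mu) <= prox_gap x y.
Proof.
move=> [z0 z0min] growth Xx [_ ymin].
set h := f x - min_value X f; set M := Num.max _ _.
have M2 : 2 <= M by rewrite le_max lexx.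
have M0 : 0 < M by lra.
have M4 : 4 * rho / mu <= M by rewrite le_max lexx orbT.
set s := 2 / M.
have s0 : 0 < s by rewrite divr_gt0.
have s1 : s <= 1 by rewrite ler_pdivrMr// mul1r.
have a0 : 0 < rho / 2 * s ^+ 2 by rewrite mulr_gt0 ?exprn_gt0 ?divr_gt0.
have : (s * h - prox_gap x y) / (rho / 2 * s ^+ 2)
    <= Defs.edist x (argmin X f) ^+ 2.
  apply: edist_sqr_ge; first by exists z0.
  move=> z zmin; have Xz := zmin.1.
  rewrite ler_pdivrMr// enorm_sqr_distC /prox_gap.
  have Xw := convex_set_segment cX Xx Xz (ltW s0) s1.
  have := ymin _ Xw; rewrite [x + _]addrC addrK enorm_sqrZ [_ *: _ + x]addrC.
  have := convex_function_segment cf Xx Xz (ltW s0) s1.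
  have := psi_le Xw; rewrite /h (min_valueE zmin); lra.
rewrite ler_pdivrMr// => gap_ge.
have {growth} d_le := growth x Xx.
rewrite -/h in d_le; set d := _ ^+ 2 in gap_ge d_le.
have d0 : 0 <= d by exact: sqr_ge0.
have sM : s * M = 2 by rewrite divfK// gt_eqF.
have rhoM : 4 * rho <= M * mu by move: M4; rewrite ler_pdivrMr.
have srho : 2 * (s * rho) <= mu.
  by have := ler_wpM2l (ltW s0) rhoM; rewrite [s * (M * _)]mulrA sM; lra.
have : s / 2 * (2 * (s * rho) * (d / 2)) <= s / 2 * h.
  apply: ler_wpM2l; first by lra.
  apply: le_trans d_le.
  rewrite (_ : _ * (d / 2) = s * rho * d); last by field.
  by rewrite ler_wpM2r//; lra.
rewrite (_ : h / M = s / 2 * h); last by rewrite /s; field; rewrite gt_eqF.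
by lra.
Qed.

Lemma enorm_prox_le x y : convex_function X psi -> X x -> prox x y ->
  rho / 2 * enorm (y - x) ^+ 2 <= prox_gap x y.
Proof.
move=> cpsi Xx yP; have := prox_strong_convexity rho_gt0 cX cpsi yP Xx.
rewrite subrr enorm_sqr0 (enorm_sqr_distC x) /prox_gap.
by have := psi_le Xx; lra.
Qed.

(** The optimal value of the subproblem drops by at most [rho * |y - x|^2] when
    its center moves from [x] to [y]: this follows from strong convexity and
    [|z - x|^2 <= 2 |z - y|^2 + 2 |y - x|^2]. By [enorm_prox_le] the drop is at
    most twice the predicted decrease. *)
Lemma prox_gap_recenter psi' x y y' : convex_function X psi ->
  (forall z, psi z <= psi' z) -> X x -> prox x y -> X y' -> f y <= f x ->
  f y - (psi' y' + rho / 2 * enorm (y' - y) ^+ 2) <= 3 * prox_gap x y.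
Proof.
move=> cpsi psi_psi' Xx yP Xy' fyx.
have := prox_strong_convexity rho_gt0 cX cpsi yP Xy'.
have := enorm_prox_le cpsi Xx yP.
have := psi_psi' y'; rewrite /prox_gap.
have := enorm_sqrD_le (y' - y) (y - x); rewrite subrKA.
rewrite -(ler_pM2l rho_gt0) mulrDr.
by lra.
Qed.

End ProxGap.

(** * Runs of the full-memory proximal bundle method *)

Section BundleRun.
Context {R : realType} {n : nat}.
Variables (X : set 'rV[R]_n) (f : 'rV[R]_n -> R) (g : 'rV[R]_n -> 'rV[R]_n).
Variables (x0 : 'rV[R]_n) (rho beta : R).
Variables (x y : nat -> 'rV[R]_n) (psi : nat -> 'rV[R]_n -> R).
Hypotheses (cX : convex_set X) (oracle : first_order_oracle X f g).
Hypotheses (Xx0 : X x0) (rho_gt0 : 0 < rho) (beta_ge0 : 0 <= beta).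
Hypothesis run : fm_pbm X f g x0 rho beta x y psi.

Local Notation serious := (serious_step f beta x y psi).

Definition model_gap (t : nat) : R := prox_gap f (psi t) rho (x t) (y t).

Let trial_argmin t := fm_pbm_trial run t.

Lemma trial_in t : X (y t).
Proof. exact: (trial_argmin t).1. Qed.

Lemma center_in t : X (x t).
Proof.
elim: t => [|t IH]; first by rewrite (fm_pbm_x0 run).
by rewrite (fm_pbm_center run); case: ifP => // _; exact: trial_in.
Qed.

Lemma model_le t z : X z -> psi t z <= f z.
Proof.
move=> Xz; elim: t => [|t IH].
  by rewrite (fm_pbm_psi0 run); exact: oracle.
rewrite (fm_pbm_model run) ge_max IH /=.
by apply: oracle => //; exact: trial_in.
Qed.

Lemma model_convex t : convex_function X (psi t).
Proof.
elim: t => [|t IH].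
  by rewrite (funext (fm_pbm_psi0 run)); exact: convex_function_cut.
rewrite (funext (fm_pbm_model run t)).
by apply: convex_function_max => //; exact: convex_function_cut.
Qed.

Lemma model_mono s t z : (s <= t)%N -> psi s z <= psi t z.
Proof.
move=> /subnK <-; elim: (t - s)%N => [//|m IH].
by rewrite addSn (fm_pbm_model run) le_max IH.
Qed.

Lemma model_cut s t z : (s < t)%N -> Defs.cut f g (y s) z <= psi t z.
Proof.
move=> st; apply: le_trans (model_mono z st).
by rewrite (fm_pbm_model run) le_max lexx orbT.
Qed.

Lemma model_gap_ge_prox t :
  rho / 2 * enorm (y t - x t) ^+ 2 <= model_gap t.
Proof.
exact: (enorm_prox_le cX rho_gt0 (@model_le t) (@model_convex t)
  (center_in t) (trial_argmin t)).
Qed.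

Lemma model_gap_ge0 t : 0 <= model_gap t.
Proof.
apply: (le_trans _ (model_gap_ge_prox t)).
by rewrite mulr_ge0 ?sqr_ge0// divr_ge0// ltW.
Qed.

Lemma model_gap_le_trial t : model_gap t <= f (x t) - psi t (y t).
Proof.
rewrite /model_gap /prox_gap lerD2l lerN2 lerDl.
by rewrite mulr_ge0 ?sqr_ge0// divr_ge0// ltW.
Qed.

Lemma serious_decrease t : serious t ->
  beta * model_gap t <= f (x t) - f (x t.+1).
Proof.
move=> ser; rewrite (fm_pbm_center run) ser.
move: ser; rewrite /serious_step; apply: le_trans.
by rewrite ler_wpM2l// model_gap_le_trial.
Qed.

Lemma model_gap_serious t : serious t -> model_gap t.+1 <= 3 * model_gap t.
Proof.
move=> ser; have := serious_decrease ser.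
rewrite /model_gap {2}/prox_gap (fm_pbm_center run) ser => dec.
apply: (prox_gap_recenter cX rho_gt0 (@model_le t) (@model_convex t)).
- by move=> z; exact: model_mono.
- exact: center_in.
- exact: trial_argmin.
- exact: trial_in.
- by rewrite -subr_ge0; apply: le_trans dec; rewrite mulr_ge0// model_gap_ge0.
Qed.

Lemma model_gap_null t : ~~ serious t -> model_gap t.+1 <= model_gap t.
Proof.
move=> /negPf nser; rewrite /model_gap /prox_gap (fm_pbm_center run) nser.
rewrite lerD2l lerN2; apply: le_trans ((trial_argmin t).2 _ (trial_in t.+1)) _.
by rewrite lerD2r model_mono.
Qed.

Lemma center_null s t : (s <= t)%N ->
  (forall r, (s <= r < t)%N -> ~~ serious r) -> x t = x s.
Proof.
elim: t => [|t IH]; first by rewrite leqn0 => /eqP ->.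
rewrite leq_eqVlt => /predU1P[->//|st] nser.
have nsert : ~~ serious t by rewrite nser// ltnSn andbT.
rewrite (fm_pbm_center run) (negPf nsert).
by apply: IH => // r /andP[sr rt]; rewrite nser// sr ltnW.
Qed.

(** A null step at [t] means that [f] exceeds the model at [y t] by at least
    [(1 - beta) * model_gap t]. This excess is at most the error at [y t] of the
    cut made at [y s], hence quadratic in [|y t - y s|], while strong convexity
    of the subproblem at [s] yields
    [rho / 2 * |y t - y s|^2 <= model_gap s - model_gap t]. *)
Lemma model_gap_repeat (L : R) s t : 0 < L -> beta <= 1 -> (s < t)%N ->
  (forall r, (s <= r <= t)%N -> ~~ serious r) ->
  f (y t) - Defs.cut f g (y s) (y t) <= L / 2 * enorm (y t - y s) ^+ 2 ->
  (theta_rate beta L rho)^-1 * model_gap t <= model_gap s.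
Proof.
move=> L0 beta1 st nser smooth.
have xts : x t = x s.
  apply: center_null; first exact: ltnW.
  by move=> r /andP[sr rt]; rewrite nser// sr ltnW.
have : beta * (f (x t) - psi t (y t)) > f (x t) - f (y t).
  by rewrite ltNge; apply: nser; rewrite leqnn ltnW.
have := model_cut (y t) st.
have := ler_wpM2l _ (model_gap_le_trial t) => /(_ (1 - beta)).
rewrite subr_ge0 => /(_ beta1) trial_gap cut_le null.
have gap_le : (1 - beta) * model_gap t <= L / 2 * enorm (y t - y s) ^+ 2.
  by apply: le_trans smooth; lra.
have := prox_strong_convexity rho_gt0 cX (@model_convex s) (trial_argmin s)
  (trial_in t).
have := model_mono (y t) (ltnW st) => mono strong.
have gap_diff : rho / 2 * enorm (y t - y s) ^+ 2 <= model_gap s - model_gap t.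
  by rewrite /model_gap /prox_gap xts; lra.
rewrite /theta_rate invf_div mulrAC ler_pdivrMr// mulrDl.
have := ler_wpM2l (ltW rho_gt0) gap_le.
have := ler_wpM2l (ltW L0) gap_diff.
by lra.
Qed.

Lemma model_gap0_le : model_gap 0 <= enorm (g x0) ^+ 2 / (2 * rho).
Proof.
rewrite /model_gap /prox_gap (fm_pbm_x0 run) (fm_pbm_psi0 run) /Defs.cut.
by have := dot_enorm_sqr_ge (g x0) (y 0%N - x0) rho_gt0; lra.
Qed.

Section Growth.
Variable mu : R.
Hypotheses (cf : convex_function X f) (mu_gt0 : 0 < mu) (beta_le1 : beta <= 1).
Hypotheses (fmin : argmin X f !=set0) (growth : quadratic_growth X f mu).

Local Notation M := (Num.max 2 (4 * rho / mu)).
Local Notation excess t := (f (x t) - min_value X f).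

Lemma model_gap_ge_excess t : excess t / M <= model_gap t.
Proof.
exact: (prox_gap_ge cX cf rho_gt0 mu_gt0 (@model_le t) fmin growth
  (center_in t) (trial_argmin t)).
Qed.

Lemma gamma_rate_gt0 : 0 < gamma_rate beta mu rho.
Proof.
have M2 : 2 <= M by rewrite le_max lexx.
have M0 : 0 < M by lra.
rewrite subr_gt0 ltr_pdivrMr// mul1r.
exact: le_lt_trans beta_le1 (lt_le_trans (ltr1n _ 2) M2).
Qed.

Lemma excess_decay t :
  excess t <= gamma_rate beta mu rho ^+ resets serious t * excess 0%N.
Proof.
elim: t => [|t IH]; first by rewrite /resets big_ord0 mul1r.
rewrite /resets big_ord_recr /=; have [ser|nser] := boolP (serious t).
  rewrite addn1 exprS -mulrA.
  apply: le_trans (ler_wpM2l (ltW gamma_rate_gt0) IH).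
  have := serious_decrease ser.
  have := ler_wpM2l beta_ge0 (model_gap_ge_excess t).
  by rewrite /gamma_rate mulrCA; lra.
by rewrite addn0 (fm_pbm_center run) (negPf nser).
Qed.

Lemma serious_count t : 0 < excess t ->
  beta * (resets serious t)%:R <= M * ln (excess 0%N / excess t).
Proof.
move=> et0.
have M2 : 2 <= M by rewrite le_max lexx.
have M0 : 0 < M by lra.
have G0 := gamma_rate_gt0; set G := gamma_rate _ _ _ in G0.
have dec := excess_decay t; rewrite -/G in dec.
set S := resets _ _ in dec *.
have GS0 : 0 < G ^+ S by exact: exprn_gt0.
have e0 : 0 < excess 0%N by rewrite -(pmulr_rgt0 _ GS0) (lt_le_trans et0).
have lnG : ln G <= - (beta / M).
  by rewrite /G /gamma_rate le_ln1Dx// ltrN2 -subr_gt0.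
have : ln (excess t) <= ln (G ^+ S * excess 0%N).
  by rewrite ler_ln ?posrE ?mulr_gt0.
rewrite lnM// lnXn// -[ln G *+ _]mulr_natr => ln_dec.
have lnGS := ler_wpM2r (ler0n R S) lnG.
rewrite mulrC -ler_pdivrMl// ln_div//.
by rewrite mulrCA [M^-1 * _]mulrC mulrC; lra.
Qed.

End Growth.

End BundleRun.

(** * The iteration bound *)

(** The reciprocal logarithm is the number of contractions by [theta_rate] that
    divide a quantity by the base [e]; its bound is [ln (1 + z) <= z] at
    [z = theta_rate beta L rho - 1]. *)
Lemma ln_theta_rate_inv {R : realType} (beta L rho : R) :
  0 < L -> 0 < rho -> beta < 1 ->
  1 < (theta_rate beta L rho)^-1 /\
  (ln (theta_rate beta L rho)^-1)^-1 <= 1 + L / ((1 - beta) * rho).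
Proof.
move=> L0 rho0 beta1; set b := (1 - beta) * rho.
have b0 : 0 < b by rewrite mulr_gt0// subr_gt0.
have Lb0 : 0 < L + b by rewrite addr_gt0.
have theta0 : 0 < theta_rate beta L rho by rewrite divr_gt0.
have theta1 : theta_rate beta L rho < 1.
  by rewrite ltr_pdivrMr// mul1r ltrDl.
split; first by rewrite invf_gt1.
have ln_le : ln (theta_rate beta L rho) <= - (b / (L + b)).
  rewrite (_ : theta_rate _ _ _ = 1 + - (b / (L + b))); last first.
    by rewrite /theta_rate -/b; field; rewrite gt_eqF.
  by rewrite le_ln1Dx// ltrN2 ltr_pdivrMr// mul1r ltrDr.
have -> : 1 + L / b = (b / (L + b))^-1 by field; rewrite !gt_eqF.
rewrite lnV ?posrE// lef_pV2 ?posrE ?divr_gt0//; first by rewrite lerNr.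
by rewrite oppr_gt0; apply: le_lt_trans ln_le _; rewrite oppr_lt0 divr_gt0.
Qed.

(** Together with [(rho / mu) * (L / rho) = L / mu], these two bounds make
    [(1 + L / rho) * (1 + rho / mu)] comparable to [1 + L / mu]. *)
Lemma ratio_bounds {R : realType} (mu L rho : R) : 0 < mu -> 0 < L ->
  Num.min mu L <= rho -> rho <= Num.max mu L ->
  rho / mu <= 1 + L / mu /\ L / rho <= 1 + L / mu.
Proof.
move=> mu0 L0 min_rho rho_max.
have rho0 : 0 < rho by apply: lt_le_trans min_rho; rewrite lt_min mu0 L0.
have Lmu0 : 0 < L / mu by rewrite divr_gt0.
split.
  rewrite ler_pdivrMr// mulrDl mul1r divfK ?gt_eqF//.
  by apply: (le_trans rho_max); rewrite ge_max lerDl lerDr (ltW mu0) (ltW L0).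
move: min_rho; rewrite ge_min => /orP[mu_rho|L_rho].
  apply: (@le_trans _ _ (L / mu)); last by rewrite lerDr.
  by rewrite ler_pM2l// lef_pV2.
by apply: (@le_trans _ _ 1); rewrite ?ler_pdivrMr ?mul1r// lerDl ltW.
Qed.

(** The constants of the final estimate. Here [K] is the number of pieces,
    [a = L / mu], [b = rho / mu], [c = L / rho], [S] counts the serious steps,
    [Q] is [1 / ln (1 / theta_rate)], and [l], [A], [W] are logarithms. *)
Lemma bound_arithmetic {R : realType} (K a b c l A W S t Q : R) :
  1 <= K -> 0 < a -> 0 < b -> 0 < c -> b * c = a -> b <= 1 + a -> c <= 1 + a ->
  0 <= l -> l <= A -> 0 <= W -> 0 <= S -> S <= 8 * (1 + b) * l ->
  0 <= Q -> Q <= 1 + 2 * c ->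
  t <= S + K * (S + 1 + (S * 2 + W) * Q) ->
  t + 2 <= 100 * (K * (1 + a) * (1 + A) + K * (1 + c) * W).
Proof.
move=> K1 a0 b0 c0 bc ba ca l0 lA W0 S0 Sl Q0 Qc tle.
have Sc : S * (1 + c) <= 24 * ((1 + a) * l).
  apply: le_trans (ler_wpM2r _ Sl) _; first by lra.
  rewrite (_ : _ * (1 + c) = 8 * ((1 + b + c + b * c) * l)); last by ring.
  rewrite bc -subr_ge0.
  rewrite (_ : _ - _ = 8 * ((2 + 2 * a - b - c) * l)); last by ring.
  by rewrite !mulr_ge0//; lra.
have SQ : (S * 2 + W) * Q <= (S * 2 + W) * (1 + 2 * c).
  by rewrite ler_wpM2l// addr_ge0// mulr_ge0.
have al : (1 + a) * l <= (1 + a) * A by rewrite ler_wpM2l//; lra.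
have cW : 0 <= c * W by rewrite mulr_ge0// ltW.
have KS : S <= K * S by rewrite ler_peMl.
have aA : 0 <= a * A by rewrite mulr_ge0 ?(ltW a0) ?(le_trans l0).
have main : 2 + S + (S + 1 + (S * 2 + W) * Q)
    <= 100 * ((1 + a) * (1 + A) + (1 + c) * W).
  lra.
have := ler_wpM2l (le_trans ler01 K1) main; lra.
Qed.

Section IterationBound.
Context {R : realType} {n : nat}.
Variables (X : set 'rV[R]_n) (f : 'rV[R]_n -> R) (g : 'rV[R]_n -> 'rV[R]_n).
Variables (k : nat) (L : R) (P : 'I_k -> set 'rV[R]_n) (mu : R).
Variables (x0 : 'rV[R]_n) (eps rho : R).
Variables (x y : nat -> 'rV[R]_n) (psi : nat -> 'rV[R]_n -> R).
Hypotheses (cX : convex_set X) (cf : convex_function X f).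
Hypotheses (fmin : argmin X f !=set0) (oracle : first_order_oracle X f g).
Hypotheses (k_gt0 : (0 < k)%N) (L_gt0 : 0 < L).
Hypotheses (cover : X `<=` \bigcup_i P i) (smooth : oracle_smooth f g L P).
Hypotheses (mu_gt0 : 0 < mu) (growth : quadratic_growth X f mu).
Hypotheses (Xx0 : X x0) (eps_gt0 : 0 < eps).
Hypothesis eps_lt : eps < f x0 - min_value X f.
Hypothesis min_le_rho : Num.min mu L <= rho.
Hypothesis rho_le_max : rho <= Num.max mu L.
Hypothesis run : fm_pbm X f g x0 rho (1 / 2) x y psi.

Local Notation excess t := (f (x t) - min_value X f).
Local Notation serious := (serious_step f (1 / 2) x y psi).
Local Notation gap := (model_gap f rho x y psi).
Local Notation M := (Num.max 2 (4 * rho / mu)).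
Local Notation W := (2 * enorm (g x0) ^+ 2 / (Num.min rho mu * eps)).

Let rho_gt0 : 0 < rho.
Proof. by apply: lt_le_trans min_le_rho; rewrite lt_min mu_gt0. Qed.

Let half_ge0 : (0 : R) <= 1 / 2.
Proof. by lra. Qed.

Let half_le1 : (1 / 2 : R) <= 1.
Proof. by lra. Qed.

Let half_lt1 : (1 / 2 : R) < 1.
Proof. by lra. Qed.

Let M_gt0 : 0 < M.
Proof. by rewrite lt_max ltr0n. Qed.

Let gap_gt t : eps < excess t -> eps / M < gap t.
Proof.
move=> et; apply: lt_le_trans (model_gap_ge_excess cX oracle Xx0 rho_gt0 run
  cf mu_gt0 fmin growth t).
by rewrite ltr_pM2r ?invr_gt0.
Qed.

(** Here [M / (2 * rho) = max (1 / rho, 2 / mu) <= 2 / min (rho, mu)]. *)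
Let gap0_ratio d : eps / M < d -> gap 0 / d <= W.
Proof.
move=> dM; have d0 : 0 < d by apply: le_lt_trans dM; rewrite divr_ge0 ?ltW.
have min0 : 0 < Num.min rho mu by rewrite lt_min rho_gt0.
have Mmin : M * Num.min rho mu <= 4 * rho.
  have [_|_] := leP 2 (4 * rho / mu).
    apply: (@le_trans _ _ (4 * rho / mu * mu)); last by rewrite divfK ?gt_eqF.
    by rewrite ler_pM2l ?divr_gt0 ?mulr_gt0// ge_min lexx orbT.
  have : Num.min rho mu <= rho by rewrite ge_min lexx.
  lra.
have gap0 := model_gap0_le rho_gt0 run.
rewrite ler_pdivrMr//; apply: (le_trans gap0).
have g0 : 0 <= enorm (g x0) ^+ 2 by exact: sqr_ge0.
apply: (@le_trans _ _ (W * (eps / M))); last first.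
  apply: ler_wpM2l; last exact: ltW.
  by apply: divr_ge0; [lra | rewrite ltW// mulr_gt0].
rewrite (_ : W * _ = enorm (g x0) ^+ 2 * (2 / (M * Num.min rho mu)));
  last first.
  by field; rewrite !gt_eqF.
rewrite ler_wpM2l// ler_pdivlMr ?mulr_gt0// ler_pdivrMl ?mulr_gt0//.
lra.
Qed.

Let excess0_gt : eps < excess 0%N.
Proof. by rewrite (fm_pbm_x0 run). Qed.

Local Notation q := (theta_rate (1 / 2) L rho)^-1.

Lemma iteration_count t : eps < excess t ->
  t%:R <= (resets serious t)%:R + k%:R * ((resets serious t).+1%:R
    + ((resets serious t)%:R * ln 3 + ln (gap 0%N / gap t)) / ln q).
Proof.
move=> et.
have piece s : exists i, P i (y s).
  by have [i _ Pi] := cover (trial_in run s); exists i.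
have [label labelP] := choice piece.
have [q1 _] := ln_theta_rate_inv L_gt0 rho_gt0 half_lt1.
have epsM : 0 < eps / M by rewrite divr_gt0.
apply: (potential_count (label := label)) => //.
- exact: ltW.
- exact: (model_gap_serious cX oracle Xx0 rho_gt0 half_ge0 run).
- exact: (model_gap_null run).
- move=> s r sr null lab.
  apply: (model_gap_repeat cX rho_gt0 run L_gt0 half_le1 sr null).
  by apply: (smooth (i := label r)) => //; rewrite -lab.
- exact: lt_trans epsM (gap_gt excess0_gt).
- exact: lt_trans epsM (gap_gt et).
Qed.

Lemma oracle_call_bound t : eps < excess t ->
  t%:R + 2 <= 100 * (k%:R * (1 + L / mu)
      * (1 + ln ((f x0 - min_value X f) / (eps * Num.min 1 (mu / rho))))
    + k%:R * (1 + L / rho) * ln W).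
Proof.
move=> et; rewrite -{1}(fm_pbm_x0 run).
have [q1 lnqV] := ln_theta_rate_inv L_gt0 rho_gt0 half_lt1.
have epsM : 0 < eps / M by rewrite divr_gt0.
have [rho_mu L_rho] := ratio_bounds mu_gt0 L_gt0 min_le_rho rho_le_max.
have gap0_gt0 := lt_trans epsM (gap_gt excess0_gt).
have gapt_gt0 := lt_trans epsM (gap_gt et).
have W1 : 1 <= W.
  by have := gap0_ratio (gap_gt excess0_gt); rewrite divff// gt_eqF.
have lnW : ln (gap 0%N / gap t) <= ln W.
  have W0 : 0 < W by exact: lt_le_trans W1.
  by rewrite ler_ln ?posrE ?W0 ?divr_gt0// gap0_ratio// gap_gt.
have ln3 : ln (3 : R) <= 2.
  by rewrite (_ : 3 = 1 + 2) ?le_ln1Dx//; lra.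
have e0 : 0 < excess 0%N by exact: lt_trans eps_gt0 excess0_gt.
have et0 : 0 < excess t by exact: lt_trans eps_gt0 et.
set S := resets serious t.
have S_le : S%:R <= 8 * (1 + rho / mu) * ln (excess 0%N / eps).
  have := serious_count cX oracle Xx0 rho_gt0 half_ge0 run cf mu_gt0 half_le1
    fmin growth et0.
  rewrite -/S => count.
  have ln_et : ln (excess 0%N / excess t) <= ln (excess 0%N / eps).
    by rewrite ler_ln ?posrE ?divr_gt0// ler_pM2l// lef_pV2 ?posrE ?ltW.
  have M_le : M <= 4 * (1 + rho / mu).
    have : 0 < rho / mu by rewrite divr_gt0.
    by rewrite ge_max -mulrA; lra.
  have l0 : 0 <= ln (excess 0%N / eps).
    by rewrite ln_ge0// ler_pdivlMr// mul1r ltW.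
  have := ler_wpM2l (ltW M_gt0) ln_et.
  have := ler_wpM2r l0 M_le.
  by lra.
apply: (bound_arithmetic (b := rho / mu) (l := ln (excess 0%N / eps))
  (S := S%:R) (Q := (ln q)^-1)) => //.
- by rewrite ler1n.
- exact: divr_gt0.
- exact: divr_gt0.
- exact: divr_gt0.
- by field; rewrite !gt_eqF.
- by rewrite ln_ge0// ler_pdivlMr// mul1r ltW.
- have m0 : 0 < Num.min 1 (mu / rho) by rewrite lt_min ltr01 divr_gt0.
  rewrite ler_ln ?posrE ?divr_gt0 ?mulr_gt0// ler_pM2l//.
  by rewrite lef_pV2 ?posrE ?mulr_gt0// ger_pMr// ge_min lexx.
- exact: ln_ge0.
- by rewrite invr_ge0 ltW// ln_gt0.
- apply: (le_trans lnqV).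
  by rewrite (_ : L / _ = 2 * (L / rho))//; field; rewrite gt_eqF.
apply: (le_trans (iteration_count et)); rewrite -/S lerD2l.
rewrite ler_wpM2l// -natr1 lerD2l ler_wpM2r ?invr_ge0 ?(ltW (ln_gt0 q1))//.
by rewrite lerD// ler_wpM2l.
Qed.

(** If [t.+1] is the first index with excess at most [eps], the center changed
    at [t], so step [t] is serious; the bound is then used at [t], where the
    excess is still larger than [eps]. The 2 accounts for the calls at [x0] and
    at [y t]. *)
Lemma serious_center_reached T :
  (forall t, eps < excess t -> t%:R + 2 <= T) ->
  serious_center_within X f (1 / 2) x y psi eps T.
Proof.
move=> bound.
have reached : exists t, excess t <= eps.
  exists (Num.trunc T).+1; rewrite leNgt; apply/negP => /bound.
  by have := truncnS_gt T; lra.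
have [[|t] ht min_t] := ex_minnP reached.
  by have := excess0_gt; rewrite ltNge ht.
have et : eps < excess t.
  by rewrite ltNge; apply/negP => /min_t; rewrite ltnn.
exists t; split=> //.
  apply/negPn/negP => nser; move: ht.
  by rewrite (fm_pbm_center run) (negPf nser) leNgt et.
by rewrite /oracle_calls add1n -addn2 natrD bound.
Qed.

End IterationBound.

Theorem corollary4p1 (R : realType) :
  exists C : R, 0 < C /\
  forall (n : nat) (X : set 'rV[R]_n) (f : 'rV[R]_n -> R)
    (g : 'rV[R]_n -> 'rV[R]_n) (k : nat) (L : R) (P : 'I_k -> set 'rV[R]_n)
    (mu : R) (x0 : 'rV[R]_n) (eps beta rho : R)
    (x y : nat -> 'rV[R]_n) (psi : nat -> 'rV[R]_n -> R),
  X !=set0 -> closed X -> convex_set X ->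
  convex_function X f -> lsc_on X f -> argmin X f !=set0 ->
  first_order_oracle X f g ->
  (0 < k)%N -> 0 < L -> piecewise_smooth X f L P -> oracle_smooth f g L P ->
  growth_modulus X f = mu%:E -> 0 < mu ->
  X x0 -> 0 < eps -> eps < f x0 - min_value X f ->
  beta = 1 / 2 ->
  Num.min mu L <= rho -> rho <= Num.max mu L ->
  fm_pbm X f g x0 rho beta x y psi ->
  let gap := f x0 - min_value X f in
  let reached_within := serious_center_within X f beta x y psi eps in
  [/\ reached_within
        (C * (k%:R * (1 + L / mu)
                * (1 + ln (gap / (eps * Num.min 1 (mu / rho))))
              + k%:R * (1 + L / rho)
                * ln (2 * enorm (g x0) ^+ 2 / (Num.min rho mu * eps)))),
      rho = mu ->
        [/\ gamma_rate beta mu rho = 7 / 8,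
            theta_rate beta L rho = L / (L + mu / 2) &
            reached_within
              (C * (k%:R * (1 + L / mu)
                      * (1 + ln (gap / eps)
                         + ln (2 * enorm (g x0) ^+ 2 / (mu * eps)))))] &
      rho = L ->
        [/\ theta_rate beta L rho = 2 / 3,
            gamma_rate beta mu rho = 1 - 1 / (2 * Num.max 2 (4 * L / mu)) &
            reached_within
              (C * (k%:R * (1 + L / mu)
                      * (1 + ln ((1 + L / mu) * gap / eps))
                    + k%:R
                      * ln (2 * enorm (g x0) ^+ 2 / (Num.min L mu * eps))))]].
Proof.
exists 200; split=> // n X f g k L P mu x0 eps beta rho x y psi.
move=> _ _ cX cf _ fmin oracle k0 L0 [_ cover _] smooth muE mu0 Xx0 eps0 eps_lt.
move=> -> min_rho rho_max run gap reached_within.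
have growth := quadratic_growth_modulus fmin muE.
have rho0 : 0 < rho by apply: lt_le_trans min_rho; rewrite lt_min mu0.
have reach := serious_center_reached eps_lt run.
have calls := oracle_call_bound cX cf fmin oracle k0 L0 cover smooth mu0 growth
  Xx0 eps0 eps_lt min_rho rho_max run.
have e0 : eps < f (x 0%N) - min_value X f by rewrite (fm_pbm_x0 run).
have gap0 : 0 < gap by exact: lt_trans eps_lt.
(* 100 suffices here; the factor 2 absorbs [1 + L / rho = 2] when [rho = L]. *)
have main : reached_within
    (200 * (k%:R * (1 + L / mu) * (1 + ln (gap / (eps * Num.min 1 (mu / rho))))
      + k%:R * (1 + L / rho)
        * ln (2 * enorm (g x0) ^+ 2 / (Num.min rho mu * eps)))).
  apply: reach => t et; have := calls t et; have := calls _ e0.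
  by rewrite -/gap; lra.
split=> // rho_eq; rewrite rho_eq in main *.
- split.
  + rewrite /gamma_rate mulfK ?gt_eqF// max_r ?ler_nat//; lra.
  + by congr (_ / (_ + _)); lra.
  + move: main; rewrite divff ?gt_eqF// !minxx mulr1.
    by rewrite -mulrDr.
- split.
  + by rewrite /theta_rate; field; rewrite gt_eqF//; lra.
  + by rewrite /gamma_rate invfM mulrA.
  + apply: reach => t et; have := calls t et.
    rewrite rho_eq divff ?gt_eqF// -/gap => Bt.
    have LmuP : 0 < 1 + L / mu by rewrite addr_gt0 ?divr_gt0.
    have m0 : 0 < Num.min 1 (mu / L) by rewrite lt_min ltr01 divr_gt0.
    have : ln (gap / (eps * Num.min 1 (mu / L))) <=
           ln ((1 + L / mu) * gap / eps).
      rewrite ler_ln ?posrE ?divr_gt0 ?mulr_gt0//.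
      rewrite invfM mulrA mulrC -mulrA ler_pM2r ?divr_gt0//.
      rewrite minC /Num.min; case: ifP => _; last first.
        by rewrite invr1 lerDl ltW ?divr_gt0.
      by rewrite invf_div lerDr.
    have l0 : 0 <= ln ((1 + L / mu) * gap / eps).
      rewrite ln_ge0// ler_pdivlMr// mul1r (le_trans (ltW eps_lt))//.
      by rewrite ler_peMl ?(ltW gap0)// lerDl ltW// divr_gt0.
    have kL0 : 0 <= k%:R * (1 + L / mu) by rewrite mulr_ge0 ?(ltW LmuP).
    have := mulr_ge0 kL0 l0.
    by move=> + /(ler_wpM2l kL0); lra.
Qed.
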